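(* Let $k$ and $\omega$ be two circles in the plane such that $\omega$ lies inside $k$. For any line $t$ tangent to $\omega$, let $\omega_1$ and $\omega_2$ be the two circles which are tangent externally to $\omega$, tangent internally to $k$, tangent to $t$, and lie on the same side of $t$ as $\omega$. If for some position of the tangent line $t$ the three circles $\omega$, $\omega_1$, $\omega_2$ have a second common external tangent $u$ (i.e. a common external tangent $u \neq t$), then for every position of the tangent line $t$ the corresponding three circles $\omega$, $\omega_1$, $\omega_2$ have a second common external tangent $u \neq t$.
   Context: A common external tangent of several circles is a line tangent to all of them and having all of them on the same side. *)

(* Defs.v *)
From HB Require Import structures.
From mathcomp Require Import all_boot all_order all_algebra.
From mathcomp Require Import boolp classical_sets reals.

Set Implicit Arguments.
Unset Strict Implicit.
Unset Printing Implicit Defensive.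

Import Order.TTheory GRing.Theory Num.Theory.

Local Open Scope classical_set_scope.
Local Open Scope ring_scope.

Section PlaneGeometry.
Variable R : realType.

Definition plane : Type := (R * R)%type.

(* The library's norm on [R * R] is the max norm, hence this definition. *)
Definition edist (p q : plane) : R :=
  Num.sqrt ((p.1 - q.1) ^+ 2 + (p.2 - q.2) ^+ 2).

Record circle := Circle {
  center : plane;
  radius : R;
  radius_gt0 : 0 < radius }.

Definition circle_points (c : circle) : set plane :=
  [set p | edist p (center c) = radius c].

Definition circle_interior (c : circle) : set plane :=
  [set p | edist p (center c) < radius c].

Definition line_eqn (a b c : R) : set plane :=
  [set p | a * p.1 + b * p.2 = c].

Definition is_line (t : set plane) : Prop :=
  exists a b c : R, (a, b) <> (0, 0) /\ t = line_eqn a b c.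

(* Both open half-planes bounded by [t] arise: negate [a], [b] and [c]. *)
Definition side_of_line (t H : set plane) : Prop :=
  exists a b c : R, [/\ (a, b) <> (0, 0), t = line_eqn a b c
                      & H = [set p | c < a * p.1 + b * p.2]].

Definition tangent_line (t : set plane) (c : circle) : Prop :=
  is_line t /\ exists p, t `&` circle_points c = [set p].

(* The circle may touch the bounding line, as tangent circles do. *)
Definition lies_on_side (t H : set plane) (c : circle) : Prop :=
  circle_points c `<=` H `|` t.

Definition same_side (t : set plane) (c c' : circle) : Prop :=
  exists H, [/\ side_of_line t H, lies_on_side t H c & lies_on_side t H c'].

Definition lies_inside (c k : circle) : Prop :=
  circle_points c `<=` circle_interior k.

Definition externally_tangent (c c' : circle) : Prop :=
  (exists p, circle_points c `&` circle_points c' = [set p]) /\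
  circle_interior c `&` circle_interior c' = set0.

(* [c] touches [k] from within. *)
Definition internally_tangent (c k : circle) : Prop :=
  (exists p, circle_points c `&` circle_points k = [set p]) /\
  circle_interior c `<=` circle_interior k.

Definition common_external_tangent (t : set plane) (S : set circle) : Prop :=
  (forall c, S c -> tangent_line t c) /\
  exists2 H, side_of_line t H & forall c, S c -> lies_on_side t H c.

Definition companion (k w : circle) (t : set plane) (c : circle) : Prop :=
  [/\ externally_tangent w c, internally_tangent c k,
      tangent_line t c & same_side t w c].

(* There are always exactly two companions when [w] lies inside [k] and [t] is
   tangent to [w]; [w1] and [w2] are "the" two, in either order. *)
Definition the_two_companions (k w : circle) (t : set plane)
    (w1 w2 : circle) : Prop :=
  w1 <> w2 /\ [set c | companion k w t c] = [set w1; w2].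

Definition has_second_common_tangent (k w : circle) (t : set plane) : Prop :=
  exists w1 w2, the_two_companions k w t w1 w2 /\
    exists u, u <> t /\ common_external_tangent u [set w; w1; w2].

End PlaneGeometry.

(* Main.v *)
(* Let [o], [r] be the centre and radius of [w], [n] the unit normal of [t]
   pointing to the side of [w], and [m] its rotation by a right angle.  A circle
   tangent to [w] and [t] in the required way has centre
   [o + (s ^ 2 / (4 r) - r) n + s m] for some [s <> 0], and tangency to [k] is a
   quadratic equation in [s] with two roots [s1], [s2] of opposite signs.  A
   second common tangent exists iff the three centres are collinear, i.e. iff
   [s1 * s2 = - 4 r ^ 2].  By Vieta this says
   [(radius k - r) ^ 2 = |o - center k| ^ 2 + 4 r ^ 2], where [t] no longer
   occurs. *)
Require Import Defs.
From mathcomp Require Import all_boot all_order all_algebra.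
From mathcomp Require Import boolp classical_sets reals.
From mathcomp Require Import ring lra.

Set Implicit Arguments.
Unset Strict Implicit.
Unset Printing Implicit Defensive.

Import Order.TTheory GRing.Theory Num.Theory.

Local Open Scope classical_set_scope.
Local Open Scope ring_scope.

(** * Euclidean distance and its square *)

Section Distance.
Variable R : realType.
Implicit Types (p q o : plane R) (r : R).

(** Being polynomial in the coordinates, it lets [ring] settle the metric identities; [edist_eqP]
    and [edist_ltP] trade [edist] for it. *)
Definition sqdist p q : R := (p.1 - q.1) ^+ 2 + (p.2 - q.2) ^+ 2.

Lemma sqdist_ge0 p q : 0 <= sqdist p q.
Proof. by rewrite addr_ge0 ?sqr_ge0. Qed.

Lemma sqdist_eq0 p q : sqdist p q = 0 -> p = q.
Proof.
move=> /eqP; rewrite paddr_eq0 ?sqr_ge0 // !sqrf_eq0 !subr_eq0.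
by case: p q => [x y] [x' y'] /= /andP[/eqP -> /eqP ->].
Qed.

Lemma edist_ge0 p q : 0 <= edist p q.
Proof. exact: sqrtr_ge0. Qed.

Lemma sqr_edist p q : edist p q ^+ 2 = sqdist p q.
Proof. by rewrite sqr_sqrtr ?sqdist_ge0. Qed.

Lemma edistC p q : edist p q = edist q p.
Proof. by rewrite /edist -(sqrrN (p.1 - _)) -(sqrrN (p.2 - _)) !opprB. Qed.

Lemma edist_eqP p q r : 0 <= r -> edist p q = r <-> sqdist p q = r ^+ 2.
Proof.
move=> r0; split=> [<-|h]; first by rewrite sqr_edist.
by rewrite /edist -/(sqdist p q) h sqrtr_sqr ger0_norm.
Qed.

Lemma edist_ltP p q r : 0 <= r -> edist p q < r <-> sqdist p q < r ^+ 2.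
Proof. by move=> r0; rewrite -sqr_edist ltr_sqr ?nnegrE ?edist_ge0. Qed.

(** After squaring, this is Cauchy-Schwarz for the vectors [p - o] and [o - q]. Lagrange's identity
    supplies it: the defect is the square of their cross product. *)
Lemma edist_triangle o p q : edist p q <= edist p o + edist o q.
Proof.
rewrite -ler_sqr ?nnegrE ?addr_ge0 ?edist_ge0 // sqr_edist sqrrD !sqr_edist.
set u := edist p o; set v := edist o q.
pose x := (p.1 - o.1) * (o.1 - q.1) + (p.2 - o.2) * (o.2 - q.2).
have xuv : x <= u * v.
  have [x0|x0] := leP x 0; first by rewrite (le_trans x0) ?mulr_ge0 ?edist_ge0.
  rewrite -ler_sqr ?nnegrE ?mulr_ge0 ?edist_ge0 ?(ltW x0) //.
  rewrite exprMn !sqr_edist -subr_ge0.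
  have -> : sqdist p o * sqdist o q - x ^+ 2 =
    ((p.1 - o.1) * (o.2 - q.2) - (p.2 - o.2) * (o.1 - q.1)) ^+ 2.
    by rewrite /sqdist /x; ring.
  exact: sqr_ge0.
have -> : sqdist p q = sqdist p o + x *+ 2 + sqdist o q.
  by rewrite /sqdist /x; ring.
by rewrite lerD2r lerD2l lerMn2r.
Qed.

End Distance.

(** * Tangency and inclusion of circles in terms of centres and radii *)

Section TangentCircles.
Variable R : realType.
Implicit Types (c k w : circle R) (p q : plane R).

Lemma circle_pointsE c p :
  circle_points c p <-> sqdist p (center c) = radius c ^+ 2.
Proof. by apply: edist_eqP; apply: ltW (radius_gt0 c). Qed.

Lemma circle_eq c c' : center c = center c' -> radius c = radius c' -> c = c'.
Proof.
case: c c' => [o r r0] [o' r' r0'] /= eo er.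
by subst o' r'; rewrite (bool_irrelevance r0 r0').
Qed.

Lemma center_interior c : circle_interior c (center c).
Proof.
apply/(edist_ltP _ _ (ltW (radius_gt0 c))).
by rewrite /sqdist !subrr expr0n addr0 exprn_gt0 ?radius_gt0.
Qed.

(* A common point of two circles stays common after reflection in the line of
   centres, so a unique one lies on that line. *)
Lemma unique_common_point c c' p :
    circle_points c `&` circle_points c' = [set p] ->
  let d := edist (center c) (center c') in
  0 < d /\ [\/ d = radius c + radius c', d = radius c - radius c'
             | d = radius c' - radius c].
Proof.
move=> E d.
have [pc pc'] : circle_points c p /\ circle_points c' p.
  by have : [set p] p by []; rewrite -E.
have uniq q : circle_points c q -> circle_points c' q -> q = p.
  by move=> qc qc'; have : [set p] q by rewrite -E.
move/circle_pointsE in pc; move/circle_pointsE in pc'.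
have r0 := radius_gt0 c; have r0' := radius_gt0 c'.
have d0 : 0 <= d by apply: edist_ge0.
have dd : d ^+ 2 = sqdist (center c) (center c') by rewrite sqr_edist.
move: uniq pc pc' dd; set r := radius c in r0 *; set r' := radius c' in r0' *.
case Eo : (center c) => [x y]; case Eo' : (center c') => [x' y'].
case: p E => [u v] _ uniq; rewrite /sqdist /= => pc pc' dd.
have {}uniq q : sqdist q (x, y) = r ^+ 2 -> sqdist q (x', y') = r' ^+ 2 ->
    q = (u, v).
  by rewrite -Eo -Eo' => h h'; apply: uniq; apply/circle_pointsE.
have [dE|dN] := eqVneq d 0.
  have [ex ey] : (x, y) = (x', y').
    by apply: sqdist_eq0; rewrite /sqdist -dd dE expr0n.
  (* For concentric circles, the point opposite to [p] is also common, which would force the radius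
     to be zero. *)
  have := uniq (2 * x - u, 2 * y - v).
  rewrite /sqdist /= -ex -ey => h.
  have {}h : (2 * x - u, 2 * y - v) = (u, v).
    by apply: h; [rewrite -pc; ring | rewrite -pc' -ex -ey; ring].
  case: h => h1 h2.
  have hx : u - x = 0 by lra.
  have hy : v - y = 0 by lra.
  move: pc; rewrite hx hy expr0n addr0 => /esym/eqP.
  by rewrite sqrf_eq0 gt_eqF.
have d1 : 0 < d by rewrite lt_def dN.
split=> //.
(* The cross product of the line of centres with the radius to [p]. The point built with [l] below
   is the reflection of [p] in that line, so uniqueness gives [z = 0]. *)
pose z := (x' - x) * (v - y) - (y' - y) * (u - x).
have z0 : z = 0.
  pose l := 2 * z / d ^+ 2.
  have ld : l * d ^+ 2 = 2 * z by rewrite /l divfK // expf_neq0.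
  have h : (u + l * (y' - y), v - l * (x' - x)) = (u, v).
    apply: uniq; rewrite /sqdist /=.
      rewrite -pc; apply/eqP; rewrite -subr_eq0; apply/eqP.
      transitivity (l * (l * d ^+ 2 - 2 * z)); last by rewrite ld subrr mulr0.
      by rewrite dd /z; ring.
    rewrite -pc'; apply/eqP; rewrite -subr_eq0; apply/eqP.
    transitivity (l * (l * d ^+ 2 - 2 * z)); last by rewrite ld subrr mulr0.
    by rewrite dd /z; ring.
  case: h => h1 h2.
  have e1 : l * (y' - y) = 0 by lra.
  have e2 : l * (x' - x) = 0 by lra.
  suff : 2 * z = 0 by lra.
  rewrite -ld dd.
  transitivity (- (l * (x' - x)) * (x - x') - (l * (y' - y)) * (y - y')).
    by ring.
  by rewrite e1 e2 oppr0 !mul0r subr0.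
(* The matching inner product: [aE] is the law of cosines, and Lagrange's identity with [z = 0]
   leaves [a = d * r] or [a = - d * r]. Each value makes a quadratic in [d] factor. *)
pose a := (x' - x) * (u - x) + (y' - y) * (v - y).
have aE : 2 * a = d ^+ 2 + r ^+ 2 - r' ^+ 2.
  by rewrite dd -pc -pc' /a; ring.
have : (a - d * r) * (a + d * r) = 0.
  transitivity (a ^+ 2 + z ^+ 2 - d ^+ 2 * r ^+ 2); last first.
    by rewrite dd -pc /a /z; ring.
  by rewrite z0; ring.
move/eqP; rewrite mulf_eq0 => /orP[] /eqP ad.
  have : (d - r - r') * (d - r + r') = 0.
    transitivity (d ^+ 2 + r ^+ 2 - r' ^+ 2 - 2 * (d * r)); first by ring.
    by rewrite -aE; lra.
  move/eqP; rewrite mulf_eq0 => /orP[] /eqP h; [apply: Or31|apply: Or32]; lra.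
have : (d + r - r') * (d + r + r') = 0.
  transitivity (d ^+ 2 + r ^+ 2 - r' ^+ 2 + 2 * (d * r)); first by ring.
  by rewrite -aE; lra.
move/eqP; rewrite mulf_eq0 => /orP[] /eqP h; [apply: Or33|]; lra.
Qed.

(* [e = r] for external tangency, [e = - r] when [c] touches [c'] from within. *)
Lemma common_pointE c c' (e : R) :
    let d := edist (center c) (center c') in
    0 < d -> e ^+ 2 = radius c ^+ 2 -> (d - e) ^+ 2 = radius c' ^+ 2 ->
  exists p, circle_points c `&` circle_points c' = [set p].
Proof.
move=> d d0 er er'.
have dd : d ^+ 2 = sqdist (center c) (center c') by rewrite sqr_edist.
move: dd.
case Eo : (center c) => [x y]; case Eo' : (center c') => [x' y'] dd.
(* The contact point lies on the line of centres at signed distance [e] from the centre of [c]. Its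
   uniqueness comes from Stewart's theorem, which writes the squared distance to it through those to
   the two centres. *)
pose l := e / d.
have ld : l * d = e by rewrite /l divfK // gt_eqF.
exists (x + l * (x' - x), y + l * (y' - y)).
rewrite eqEsubset; split=> [[u v] [/= /circle_pointsE + /circle_pointsE]|_ ->].
  rewrite Eo Eo' -er -er' => h h'; apply: sqdist_eq0.
  transitivity (sqdist (u, v) (x, y) * (1 - l)
    + l * sqdist (u, v) (x', y') - l * d ^+ 2 + l ^+ 2 * d ^+ 2).
    by rewrite dd /sqdist /=; ring.
  by rewrite h h' -ld; ring.
split; apply/circle_pointsE.
  by rewrite -er -ld Eo exprMn dd /sqdist /=; ring.
rewrite -er' -ld.
have -> : (d - l * d) ^+ 2 = (1 - l) ^+ 2 * d ^+ 2 by ring.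
by rewrite dd Eo' /sqdist /=; ring.
Qed.

(** When [d] is a difference of the radii, the centre of the smaller circle is interior to both, so
    disjointness of the interiors leaves only the sum. Conversely, the triangle inequality keeps the
    interiors apart. *)
Lemma externally_tangentP c c' : externally_tangent c c' <->
  edist (center c) (center c') = radius c + radius c'.
Proof.
have r0 := radius_gt0 c; have r0' := radius_gt0 c'.
split=> [[[p /unique_common_point[]]]|dE].
  set d := edist _ _ => d0 dE disj.
  have out q : circle_interior c q -> circle_interior c' q -> False.
    by move=> h h'; have : (set0 : set (plane R)) q by rewrite -disj.
  case: dE => // dE; exfalso.
    apply: (out (center c')); last exact: center_interior.
    by rewrite /circle_interior /= edistC -/d; lra.
  apply: (out (center c)); first exact: center_interior.
  by rewrite /circle_interior /= -/d; lra.
split.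
  apply: (@common_pointE _ _ (radius c)); rewrite ?dE ?addr_gt0 //.
  by rewrite addrAC subrr add0r.
rewrite -subset0 => q [h h'].
have := edist_triangle q (center c) (center c').
by move: h h'; rewrite /circle_interior /= dE (edistC (center c) q); lra.
Qed.

(** The strict inequality excludes [c = k], where the distance formula holds but the common point is
    not unique. Inclusion of the interiors rules out the other two values of the distance. *)
Lemma internally_tangentP c k : internally_tangent c k <->
  0 < edist (center c) (center k) /\
  edist (center c) (center k) = radius k - radius c.
Proof.
have r0 := radius_gt0 c; have r0' := radius_gt0 k.
split=> [[[p /unique_common_point[]]]|[d0 dE]].
  set d := edist _ _ => d0 dE sub; split=> //.
  have dd : d ^+ 2 = sqdist (center c) (center k) by rewrite sqr_edist.
  case: dE => // dE; exfalso.
    have := sub _ (center_interior c).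
    by rewrite /circle_interior /= -/d; lra.
  (* The point of [k] nearest to the centre of [c] is interior to [c]. *)
  pose l := radius k / d.
  have ld : l * d = radius k by rewrite /l divfK // gt_eqF.
  pose q : plane R := ((center k).1 + l * ((center c).1 - (center k).1),
                       (center k).2 + l * ((center c).2 - (center k).2)).
  suff /sub : circle_interior c q.
    move/edist_ltP => /(_ (ltW r0')).
    suff -> : sqdist q (center k) = radius k ^+ 2 by rewrite ltxx.
    by rewrite -ld exprMn dd /q /sqdist /=; ring.
  apply/(edist_ltP _ _ (ltW r0)).
  have -> : sqdist q (center c) = (radius k - d) ^+ 2.
    rewrite -ld.
    have -> : (l * d - d) ^+ 2 = (l - 1) ^+ 2 * d ^+ 2 by ring.
    by rewrite dd /q /sqdist /=; ring.
  have -> : radius k = radius c - d by lra.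
  rewrite -subr_gt0.
  have -> : radius c ^+ 2 - (radius c - d - d) ^+ 2 =
    4 * (d * (radius c - d)) by ring.
  by rewrite !mulr_gt0 //; lra.
split.
  by apply: (@common_pointE _ _ (- radius c)); rewrite ?sqrrN // dE opprK subrK.
move=> q; rewrite /circle_interior /= => h.
by have := edist_triangle (center c) q (center k); lra.
Qed.

(** Test the inclusion on the point of [w] farthest from the centre of [k]; if the centres coincide,
    any point of [w] serves. *)
Lemma lies_insideP w k : lies_inside w k ->
  edist (center w) (center k) + radius w < radius k.
Proof.
move=> wk; set d := edist _ _.
have r0 := radius_gt0 w; have r0' := radius_gt0 k.
have d0 : 0 <= d by apply: edist_ge0.
have dd : d ^+ 2 = sqdist (center w) (center k) by rewrite sqr_edist.
have far p : sqdist p (center w) = radius w ^+ 2 ->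
    sqdist p (center k) = (d + radius w) ^+ 2 -> d + radius w < radius k.
  move=> /circle_pointsE/wk; rewrite /circle_interior /= => h1 h2.
  have h0 : 0 <= d + radius w by rewrite addr_ge0 // ltW.
  by rewrite -((edist_eqP p (center k) h0).2 h2).
have [dE|dN] := eqVneq d 0.
  have ek : center w = center k by apply: sqdist_eq0; rewrite -dd dE expr0n.
  apply: (far ((center w).1 + radius w, (center w).2)).
    by rewrite /sqdist /=; ring.
  by rewrite dE -ek /sqdist /=; ring.
pose l := radius w / d.
have ld : l * d = radius w by rewrite /l divfK.
apply: (far ((center w).1 + l * ((center w).1 - (center k).1),
             (center w).2 + l * ((center w).2 - (center k).2))).
  by rewrite -ld exprMn dd /sqdist /=; ring.
rewrite -ld.
have -> : (d + l * d) ^+ 2 = (1 + l) ^+ 2 * d ^+ 2 by ring.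
by rewrite dd /sqdist /=; ring.
Qed.

End TangentCircles.

(** * Unit normals, tangent lines and half-planes *)

Section SupportLines.
Variable R : realType.
Implicit Types (c w : circle R) (n m p q : plane R) (t u H : set (plane R)).

Definition dot n p : R := n.1 * p.1 + n.2 * p.2.

Definition perp n : plane R := (- n.2, n.1).

Definition shift p (x : R) n : plane R := (p.1 + x * n.1, p.2 + x * n.2).

Lemma dot_shift n p x q : dot n (shift p x q) = dot n p + x * dot n q.
Proof. by rewrite /dot /shift /=; ring. Qed.

Lemma dot0 n : dot n (0, 0) = 0.
Proof. by rewrite /dot /= !mulr0 addr0. Qed.

Lemma dot_perp n : dot n (perp n) = 0.
Proof. by rewrite /dot /perp /=; ring. Qed.

Lemma dot_perpl n : dot (perp n) n = 0.
Proof. by rewrite /dot /perp /=; ring. Qed.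

Lemma dot_perpp n : dot (perp n) (perp n) = dot n n.
Proof. by rewrite /dot /perp /=; ring. Qed.

(** Pythagoras in the orthonormal frame formed by [n] and [perp n]. *)
Lemma sqdist_frame n p q : dot n n = 1 ->
  sqdist p q = (dot n p - dot n q) ^+ 2 + (dot (perp n) p - dot (perp n) q) ^+ 2.
Proof.
move=> n1; transitivity (dot n n * sqdist p q); first by rewrite n1 mul1r.
by rewrite /sqdist /dot /perp /=; ring.
Qed.

Lemma plane_frame n p q : dot n n = 1 ->
  p = shift (shift q (dot n p - dot n q) n)
            (dot (perp n) p - dot (perp n) q) (perp n).
Proof.
move=> n1; apply: sqdist_eq0; rewrite (sqdist_frame _ _ n1).
rewrite !dot_shift dot_perp dot_perpl dot_perpp n1; ring.
Qed.

Lemma sqdist_shift p x n : dot n n = 1 -> sqdist (shift p x n) p = x ^+ 2.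
Proof.
move=> n1; transitivity (x ^+ 2 * dot n n); last by rewrite n1 mulr1.
by rewrite /sqdist /shift /dot /=; ring.
Qed.

(** Divide the equation of the line by the length of its normal. The closed half-plane is recorded
    because [lies_on_side] allows contact with the line. *)
Lemma side_normal t H : side_of_line t H ->
  exists n e, [/\ dot n n = 1, t = [set p | dot n p = e]
                & H `|` t = [set p | e <= dot n p]].
Proof.
move=> [a [b [c [ab tE HE]]]].
have N0 : 0 < a ^+ 2 + b ^+ 2.
  rewrite lt_def addr_ge0 ?sqr_ge0 // andbT paddr_eq0 ?sqr_ge0 // !sqrf_eq0.
  by apply/negP => /andP[/eqP a0 /eqP b0]; apply: ab; rewrite a0 b0.
pose l := Num.sqrt (a ^+ 2 + b ^+ 2).
have l0 : 0 < l by rewrite sqrtr_gt0.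
have ll : l ^+ 2 = a ^+ 2 + b ^+ 2 by rewrite sqr_sqrtr ?ltW.
pose n : plane R := (a / l, b / l).
have dotE p : dot n p = (a * p.1 + b * p.2) / l by rewrite /dot /n /=; ring.
exists n, (c / l); split.
- transitivity ((a ^+ 2 + b ^+ 2) / l ^+ 2); first by rewrite dotE /n /=; field;
    rewrite gt_eqF.
  by rewrite -ll divff // expf_neq0 // gt_eqF.
- rewrite tE predeqE => p; rewrite /line_eqn /= dotE.
  by split=> [-> //|/divIf]; apply; rewrite gt_eqF.
- rewrite tE HE predeqE => p; rewrite /line_eqn /= dotE ler_pM2r ?invr_gt0 //.
  rewrite le_eqVlt; split=> [[->|->]|/orP[/eqP ->|]]; rewrite ?eqxx ?orbT //.
    by right.
  by left.
Qed.

Lemma normal_side n e : dot n n = 1 ->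
  side_of_line [set p | dot n p = e] [set p | e < dot n p].
Proof.
move=> n1; exists n.1, n.2, e; split=> //.
case: n n1 => a b; rewrite /dot /= => + [a0 b0].
by rewrite a0 b0 => /eqP; rewrite !mulr0 addr0 eq_sym oner_eq0.
Qed.

Lemma tangent_lineP n e c : dot n n = 1 ->
  tangent_line [set p | dot n p = e] c <->
  (dot n (center c) - e) ^+ 2 = radius c ^+ 2.
Proof.
move=> n1; set f := dot n (center c) - e.
have sqE p : dot n p = e -> sqdist p (center c) =
    f ^+ 2 + (dot (perp n) p - dot (perp n) (center c)) ^+ 2.
  by rewrite (sqdist_frame _ _ n1) => ->; rewrite /f; ring.
split=> [[_ [p pE]]|fr].
  have [/= pt /circle_pointsE pc] :
    ([set q | dot n q = e] `&` circle_points c) p by rewrite pE.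
  pose y := dot (perp n) p - dot (perp n) (center c).
  have y0 : y = 0.
    (* The mirror image of [p] in the normal through the centre is also common to line and circle,
       so [p] is the foot of that normal. *)
    have : [set p] (shift p (- 2 * y) (perp n)).
      rewrite -pE; split; first by rewrite /= dot_shift dot_perp mulr0 addr0.
      apply/circle_pointsE.
      rewrite -pc !sqE ?dot_shift ?dot_perp ?mulr0 ?addr0 //.
      by rewrite dot_perpp n1 /y; ring.
    move=> /= /(congr1 (dot (perp n))).
    by rewrite dot_shift dot_perpp n1; lra.
  by rewrite -pc sqE // -/y y0 expr0n addr0.
split; first by have [a [b [g [ab tE _]]]] := normal_side e n1; exists a, b, g.
exists (shift (center c) (- f) n); rewrite eqEsubset.
split=> [q [/= qt /circle_pointsE qc]|_ ->].
  have qy : dot (perp n) q - dot (perp n) (center c) = 0.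
    move: qc; rewrite sqE // fr => h.
    by apply/eqP; rewrite -sqrf_eq0; apply/eqP; lra.
  by rewrite /= (plane_frame q (center c) n1) qy qt /f /shift /= !mul0r !addr0
    opprB.
split; first by rewrite /= dot_shift n1 /f; ring.
by apply/circle_pointsE; rewrite sqdist_shift // sqrrN.
Qed.

Lemma halfplaneP n e c : dot n n = 1 ->
  circle_points c `<=` [set p | e <= dot n p] <->
  radius c <= dot n (center c) - e.
Proof.
move=> n1; have r0 := radius_gt0 c; split=> [sub|h p /circle_pointsE].
  have /sub : circle_points c (shift (center c) (- radius c) n).
    by apply/circle_pointsE; rewrite sqdist_shift // sqrrN.
  by rewrite /= dot_shift n1; lra.
rewrite (sqdist_frame _ _ n1) /= => hp.
have : `|dot n p - dot n (center c)| <= `|radius c|.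
  by rewrite -ler_sqr ?nnegrE // !real_normK ?num_real // -hp lerDl sqr_ge0.
by rewrite (gtr0_norm r0) ler_norml => /andP[+ _]; lra.
Qed.

(** Tangency alone fixes the signed distance of the centre up to sign, and the half-plane selects
    the positive one. The two conditions thus become one equation, linear in the centre and the
    radius. *)
Lemma signed_tangentP n e c : dot n n = 1 ->
  tangent_line [set p | dot n p = e] c /\
    circle_points c `<=` [set p | e <= dot n p] <->
  dot n (center c) - e = radius c.
Proof.
move=> n1; rewrite tangent_lineP // halfplaneP //; have r0 := radius_gt0 c.
split=> [[/eqP + h]|->] //.
by rewrite eqf_sqr => /orP[] /eqP //; lra.
Qed.

Lemma common_external_tangentP u (S : set (circle R)) :
  common_external_tangent u S <->
  exists n e, [/\ dot n n = 1, u = [set p | dot n p = e]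
    & forall c, S c -> dot n (center c) - e = radius c].
Proof.
split=> [[tan [H /side_normal[n [e [n1 uE HE]]] side]]|[n [e [n1 uE tan]]]].
  exists n, e; split=> // c Sc; apply/signed_tangentP => //.
  by rewrite -uE -HE; split; [apply: tan | apply: side].
split=> [c /tan/signed_tangentP|]; first by rewrite uE => -[].
exists [set p | e < dot n p]; first by rewrite uE; apply: normal_side.
move=> c /tan/signed_tangentP[]// _ sub p /sub /=; rewrite uE le_eqVlt.
by move=> /orP[/eqP ep|]; [right | left].
Qed.

(** Of the two opposite unit normals of [t], one points to the side of the centre of [w]. *)
Lemma tangent_line_normal t w : tangent_line t w ->
  exists n e, [/\ dot n n = 1, t = [set p | dot n p = e]
    & dot n (center w) - e = radius w].
Proof.
move=> tan; have [[a [b [c [ab tE]]]] _] := tan.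
have [|n [e [n1 nE _]]] := @side_normal t [set p | c < a * p.1 + b * p.2].
  by exists a, b, c.
have := tan; rewrite nE tangent_lineP // => /eqP.
rewrite eqf_sqr => /orP[] /eqP h; first by exists n, e.
have dotN p : dot (- n.1, - n.2) p = - dot n p by rewrite /dot /=; ring.
exists (- n.1, - n.2), (- e); split.
- by rewrite -n1 /dot /=; ring.
- by rewrite predeqE => p /=; rewrite dotN; split; lra.
- by rewrite dotN; lra.
Qed.

(** The line determines its contact point with [w], which is the centre moved by [- radius w] along
    the normal; hence it determines the normal. *)
Lemma normal_unique n e n' e' w : dot n n = 1 -> dot n' n' = 1 ->
    dot n (center w) - e = radius w -> dot n' (center w) - e' = radius w ->
  [set p | dot n p = e] = [set p | dot n' p = e'] -> n = n'.
Proof.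
move=> n1 n1' h h' E; have r0 := radius_gt0 w.
have /tangent_lineP[//|_ [p pE]] :
  (dot n (center w) - e) ^+ 2 = radius w ^+ 2 by rewrite h.
have contact m g : dot m m = 1 -> dot m (center w) - g = radius w ->
    [set p | dot n p = e] = [set p | dot m p = g] ->
    shift (center w) (- radius w) m = p.
  move=> m1 mw mE; have : [set p] (shift (center w) (- radius w) m).
    rewrite -pE mE; split; first by rewrite /= dot_shift m1; lra.
    by apply/circle_pointsE; rewrite sqdist_shift // sqrrN.
  by [].
have := contact _ _ n1' h' E; rewrite -(contact _ _ n1 h (erefl _)).
have rN : - radius w != 0 by rewrite oppr_eq0 gt_eqF.
move=> /pair_equal_spec[/addrI/(mulfI rN) e1 /addrI/(mulfI rN) e2].
by case: n n' e1 e2 {n1 n1' h h' E contact pE} => [x y] [x' y'] /= -> // ->.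
Qed.

End SupportLines.

(** * Companion circles and the criterion for a second tangent *)

Section Companions.
Variable R : realType.
Implicit Types (k w c : circle R) (n o : plane R) (s : R).

Lemma quadratic_roots (A B Q : R) : 0 < A -> 0 < Q ->
  exists s1 s2, [/\ s1 != s2, s1 + s2 = B / A, s1 * s2 = - Q / A &
    forall s, A * s ^+ 2 - B * s - Q = 0 <-> s = s1 \/ s = s2].
Proof.
move=> A0 Q0; have AN : A != 0 by rewrite gt_eqF.
have D0 : 0 < B ^+ 2 + 4 * (A * Q).
  by rewrite ltr_wpDl ?sqr_ge0 // !mulr_gt0.
pose D := Num.sqrt (B ^+ 2 + 4 * (A * Q)).
have D1 : 0 < D by rewrite sqrtr_gt0.
have DD : D ^+ 2 = B ^+ 2 + 4 * (A * Q) by rewrite sqr_sqrtr ?ltW.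
pose s1 := (B + D) / (2 * A); pose s2 := (B - D) / (2 * A).
have sumE : s1 + s2 = B / A by rewrite /s1 /s2; field.
have mulE : s1 * s2 = - Q / A.
  transitivity ((B ^+ 2 - D ^+ 2) / (4 * A ^+ 2)); first by rewrite /s1 /s2; field.
  by rewrite DD; field.
exists s1, s2; split=> //.
  rewrite -subr_eq0; have -> : s1 - s2 = D / A by rewrite /s1 /s2; field.
  by rewrite mulf_neq0 ?invr_eq0 // gt_eqF.
move=> s; have -> : A * s ^+ 2 - B * s - Q = A * ((s - s1) * (s - s2)).
  transitivity (A * (s ^+ 2 - (s1 + s2) * s + s1 * s2)); last by ring.
  by rewrite sumE mulE; field.
split=> [/eqP|[] ->]; last 2 first.
- by rewrite subrr mul0r mulr0.
- by rewrite subrr !mulr0.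
by rewrite !mulf_eq0 (negPf AN) !subr_eq0 /= => /orP[] /eqP; [left|right].
Qed.

(** The half-plane in [same_side] is only asserted to exist, but since it contains [w],
    [normal_unique] identifies its normal with [n]. *)
Lemma companion_tangentP n e k w c : dot n n = 1 ->
    dot n (center w) - e = radius w ->
  companion k w [set p | dot n p = e] c <->
  [/\ externally_tangent w c, internally_tangent c k
    & dot n (center c) - e = radius c].
Proof.
move=> n1 wn; split=> [[ext int tan [H [Hside wH cH]]]|[ext int cn]]; last first.
  have /common_external_tangentP[tan [H Hside sub]] : exists n' e', [/\
      dot n' n' = 1, [set p | dot n p = e] = [set p | dot n' p = e']
      & forall c', [set w; c] c' -> dot n' (center c') - e' = radius c'].
    by exists n, e; split=> // c' [] ->.
  by split=> //; [apply: tan; right | exists H; split=> //; apply: sub; [left|right]].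
split=> //.
have /common_external_tangentP[n' [e' [n1' E tan']]] :
  common_external_tangent [set p | dot n p = e] [set w; c].
  split=> [c' [] -> //|]; first by apply/tangent_lineP => //; rewrite wn.
  by exists H => // c' [] ->.
have wn' := tan' w (or_introl erefl); have cn' := tan' c (or_intror erefl).
have nn := normal_unique n1 n1' wn wn' E; subst n'.
by have -> : e = e' by lra.
Qed.

(* The centre of the circle touching [w] externally and the support line with
   normal [n], on the same side, whose contact point with that line is at signed
   distance [s] from the contact point of [w]; its radius is [s ^+ 2 / (4 * r)]. *)
Definition companion_center o (r : R) n s : plane R :=
  shift (shift o (s ^+ 2 / (4 * r) - r) n) s (perp n).

(** Here [a] and [b] are the coordinates of the centre of [k] in the frame at [o]. Tangency to [w]
    and to the line gives [s ^+ 2 = 4 * r * x] for the radius [x]; substituting this into the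
    squared tangency condition with [k] cancels the term in [x ^+ 2] and leaves the quadratic. *)
Lemma companionP n e k w c : lies_inside w k -> dot n n = 1 ->
    dot n (center w) - e = radius w ->
  let r := radius w in let o := center w in
  let a := dot n (center k) - dot n o in
  let b := dot (perp n) (center k) - dot (perp n) o in
  companion k w [set p | dot n p = e] c <->
  exists s, [/\ s != 0,
    (radius k + r - a) * s ^+ 2 - (4 * r * b) * s
      - 2 * r * (radius k ^+ 2 - (r + a) ^+ 2 - b ^+ 2) = 0,
    center c = companion_center o r n s & radius c = s ^+ 2 / (4 * r)].
Proof.
move=> /lies_insideP; set d := edist _ _ => dr n1 wn r o a b.
rewrite companion_tangentP //.
have r0 : 0 < r := radius_gt0 w; have rc0 := radius_gt0 c.
have rk0 := radius_gt0 k.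
have rN : r != 0 by rewrite gt_eqF.
have d0 : 0 <= d by apply: edist_ge0.
split=> [[/externally_tangentP ext /internally_tangentP[int0 int] cn]|].
  set x := radius c in rc0 ext int cn *.
  pose s := dot (perp n) (center c) - dot (perp n) o.
  have xE : dot n (center c) - dot n o = x - r by rewrite /o /r; lra.
  have s2 : s ^+ 2 = 4 * r * x.
    have /edist_eqP : edist o (center c) = r + x by [].
    move=> /(_ (addr_ge0 (ltW r0) (ltW rc0))).
    rewrite (sqdist_frame _ _ n1) -opprB xE -[X in _ + X ^+ 2]opprB -/s !sqrrN => h.
    by transitivity ((r + x) ^+ 2 - (x - r) ^+ 2); [rewrite -h; ring | ring].
  have xs : x = s ^+ 2 / (4 * r) by rewrite s2; field.
  exists s; split=> //.
  - by rewrite -sqrf_eq0 s2 !mulf_neq0 // gt_eqF.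
  - have /edist_eqP := int; rewrite -int => /(_ (ltW int0)).
    rewrite int (sqdist_frame _ _ n1).
    have -> : dot n (center c) - dot n (center k) = x - r - a.
      by rewrite /a -xE; ring.
    have -> : dot (perp n) (center c) - dot (perp n) (center k) = s - b.
      by rewrite /s /b; ring.
    move=> h; transitivity (2 * r * ((x - r - a) ^+ 2 + (s - b) ^+ 2
      - (radius k - x) ^+ 2) + (radius k - a - r) * (s ^+ 2 - 4 * r * x)).
      by ring.
    by rewrite h s2; ring.
  - by rewrite (plane_frame (center c) o n1) xE -/s /companion_center -xs.
move=> [s [sN quad cE xE]]; set x := radius c in rc0 xE *.
have s2 : s ^+ 2 = 4 * r * x by rewrite xE; field.
have dn : dot n (center c) = dot n o + (x - r).
  by rewrite cE !dot_shift n1 dot_perp -xE; ring.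
have dm : dot (perp n) (center c) = dot (perp n) o + s.
  by rewrite cE !dot_shift dot_perpl dot_perpp n1; ring.
have ext : edist o (center c) = r + x.
  apply/(edist_eqP _ _ (addr_ge0 (ltW r0) (ltW rc0))).
  rewrite (sqdist_frame _ _ n1) dn dm.
  transitivity ((x - r) ^+ 2 + s ^+ 2); first by ring.
  by rewrite s2; ring.
have sq : edist (center c) (center k) ^+ 2 = (radius k - x) ^+ 2.
  rewrite sqr_edist (sqdist_frame _ _ n1) dn dm.
  apply: (mulfI (x := 2 * r)); first by rewrite mulf_neq0 // pnatr_eq0.
  apply/eqP; rewrite -subr_eq0 -quad; apply/eqP.
  transitivity ((radius k + r - a) * (4 * r * x) - 4 * r * b * s
    - 2 * r * (radius k ^+ 2 - (r + a) ^+ 2 - b ^+ 2)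
    + 2 * r * (s ^+ 2 - 4 * r * x)).
    by rewrite /a /b; ring.
  by rewrite s2; ring.
(* The quadratic gives only the square of the distance to the centre of [k]. Either the wrong sign
   or distance zero would yield [radius k + r <= d], contradicting that [w] lies inside [k]. *)
have tri := edist_triangle (center k) o (center c); rewrite -/d ext in tri.
rewrite -/r in dr.
rewrite (edistC (center k)) in tri.
have e0 := edist_ge0 (center c) (center k).
have int : edist (center c) (center k) = radius k - x.
  by move/eqP: sq; rewrite eqf_sqr => /orP[] /eqP // h; rewrite h in tri; lra.
split; first by apply/externally_tangentP.
  apply/internally_tangentP; split=> //.
  by rewrite lt_def e0 andbT; apply/eqP => h; rewrite h in tri int; lra.
by rewrite dn /x /r /o; lra.
Qed.

(** Forward, the tangency conditions on the companions are homogeneous linear equations in the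
    coordinates of [n' - n], and a nonzero solution forces the product of the roots. Backward, the
    second tangent is constructed explicitly. *)
Lemma second_tangentP k w t : lies_inside w k -> tangent_line t w ->
  has_second_common_tangent k w t <->
  (radius k - radius w) ^+ 2 = sqdist (center w) (center k) + 4 * radius w ^+ 2.
Proof.
move=> wk /tangent_line_normal[n [e [n1 -> wn]]].
have := fun c => companionP c wk n1 wn.
set r := radius w; set o := center w => /=.
set a := dot n (center k) - _; set b := dot (perp n) (center k) - _.
set A := radius k + r - a; set P := radius k ^+ 2 - _ - _ => compP.
have r0 : 0 < r := radius_gt0 w.
have rN : r != 0 by rewrite gt_eqF.
have ddE : sqdist o (center k) = a ^+ 2 + b ^+ 2.
  by rewrite (sqdist_frame _ _ n1) /a /b; ring.
have dr := lies_insideP wk; have dd := sqr_edist o (center k).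
rewrite -/o -/r in dr; move: dr dd (edist_ge0 o (center k)).
set d := edist _ _ => dr dd d0.
have ad : a <= d.
  have : `|a| <= `|d|.
    by rewrite -ler_sqr ?nnegrE // !real_normK ?num_real // dd ddE lerDl sqr_ge0.
  by rewrite (ger0_norm d0) ler_norml => /andP[].
have A0 : 0 < A by rewrite /A; lra.
(* With [A0], this makes the roots of the quadratic real, distinct and nonzero. The inclusion of [w]
   in [k] enters through [d + r < radius k], and [a <= d] because a projection does not lengthen. *)
have P0 : 0 < P.
  have -> : P = (radius k - d - r) * (radius k + d + r) + 2 * (r * (d - a)).
    transitivity (radius k ^+ 2 - r ^+ 2 - 2 * r * a - d ^+ 2); last by ring.
    by rewrite dd ddE /P; ring.
  rewrite ltr_pwDl //; first by rewrite mulr_gt0 //; lra.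
  by rewrite mulr_ge0 // mulr_ge0 ?(ltW r0) //; lra.
have condP : (radius k - r) ^+ 2 = sqdist o (center k) + 4 * r ^+ 2 <->
    P = 2 * r * A.
  have E : P - 2 * r * A =
      (radius k - r) ^+ 2 - (sqdist o (center k) + 4 * r ^+ 2).
    by rewrite ddE /P /A; ring.
  by split=> h; apply/eqP; rewrite -subr_eq0; [rewrite E|rewrite -E]; rewrite h subrr.
have rP0 : 0 < 2 * r * P by rewrite !mulr_gt0.
have [s1 [s2 [s12 sumE mulE roots]]] := quadratic_roots (4 * r * b) A0 rP0.
have AN : A != 0 by rewrite gt_eqF.
have vieta : P = 2 * r * A <-> s1 * s2 = - (4 * r ^+ 2).
  rewrite mulE; split=> [->|h]; first by field.
  apply: (mulfI (x := 2 * r)); first by rewrite mulf_neq0 // pnatr_eq0.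
  apply: oppr_inj; rewrite -[LHS](divfK AN) h; ring.
rewrite condP vieta; split.
  move=> [w1 [w2 [[w12 compE] [u [ut]]]]].
  move=> /common_external_tangentP[n' [e' [n1' uE tan]]].
  have : companion k w [set p | dot n p = e] w1.
    by have : [set w1; w2] w1 by [left]; rewrite -compE.
  have : companion k w [set p | dot n p = e] w2.
    by have : [set w1; w2] w2 by [right]; rewrite -compE.
  move=> /compP[s' [_ /roots s'E c2 x2]] /compP[s [_ /roots sE c1 x1]].
  have ss' : s != s'.
    apply/eqP => h; apply: w12; apply: circle_eq; rewrite ?c1 ?c2 ?x1 ?x2 h //.
  have <- : s * s' = s1 * s2.
    by move: sE s'E ss' => [] -> [] ->; rewrite ?eqxx // mulrC.
  have wn' : dot n' o - e' = r by apply: tan; left; left.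
  (* The coordinates of [n' - n] in the frame. Subtracting the tangency equation of [w] from that of
     a companion eliminates [e']. *)
  pose al := dot n' n - 1; pose be := dot n' (perp n).
  have lin x c : [set w; w1; w2] c -> center c = companion_center o r n x ->
      radius c = x ^+ 2 / (4 * r) ->
      al * (x ^+ 2 - 4 * r ^+ 2) + be * (4 * r * x) = 0.
    move=> /tan + cE xE; rewrite cE xE !dot_shift => h.
    have -> : al * (x ^+ 2 - 4 * r ^+ 2) + be * (4 * r * x) =
        4 * r * ((x ^+ 2 / (4 * r) - r) * al + x * be) by field.
    suff -> : (x ^+ 2 / (4 * r) - r) * al + x * be = 0 by rewrite mulr0.
    by rewrite /al /be; lra.
  have l1 := lin _ _ (or_introl (or_intror erefl)) c1 x1.
  have l2 := lin _ _ (or_intror erefl) c2 x2.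
  (* Elimination of [be] from the two equations. If [al = 0], the unit vectors [n] and [n'] have
     inner product 1, so they agree and [u] is [t]. *)
  have : al * ((s - s') * (s * s' + 4 * r ^+ 2)) = 0.
    transitivity ((al * (s ^+ 2 - 4 * r ^+ 2) + be * (4 * r * s)) * s' -
      (al * (s' ^+ 2 - 4 * r ^+ 2) + be * (4 * r * s')) * s); first by ring.
    by rewrite l1 l2; ring.
  move=> /eqP; rewrite !mulf_eq0 (subr_eq0 s) (negPf ss') /=.
  move=> /orP[/eqP al0|/eqP]; last by lra.
  exfalso; apply: ut.
  have nn : n' = n.
    have nE : n' = shift (shift (0, 0) (dot n n') n) (dot (perp n) n') (perp n).
      rewrite {1}(plane_frame n' (0, 0) n1).
      by rewrite !dot0 !subr0.
    have dn : dot n n' = 1.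
      by move: al0; rewrite /al /dot !(mulrC (n'.1)) !(mulrC (n'.2)); lra.
    have dm : dot (perp n) n' = 0.
      have := sqdist_frame n' (0, 0) n1.
      rewrite dn; have -> : sqdist n' (0, 0) = dot n' n'.
        by rewrite /sqdist /dot /= !subr0 !expr2.
      rewrite !dot0 n1' !subr0 expr1n => h.
      by apply/eqP; rewrite -sqrf_eq0; apply/eqP; lra.
    rewrite nE dn dm /shift /= !mul0r !mul1r !add0r !addr0.
    by case: (n).
  by rewrite uE nn (_ : e' = e) //; move: wn wn'; rewrite nn -/o -/r; lra.
move=> s12E.
have nz s : s = s1 \/ s = s2 -> s != 0.
  have : s1 * s2 != 0 by rewrite s12E oppr_eq0 mulf_neq0 ?expf_neq0 ?pnatr_eq0.
  by rewrite mulf_eq0 negb_or => /andP[h1 h2] [] ->.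
have rad0 s : s = s1 \/ s = s2 -> 0 < s ^+ 2 / (4 * r).
  by move/nz => sN; rewrite divr_gt0 ?exprn_even_gt0 ?sN // mulr_gt0.
(* The argument [h], a proof that [s] is a root, supplies the positive radius that a circle must
   carry. *)
pose mk s h : circle R := Circle (companion_center o r n s) (rad0 s h).
have s1P : s1 = s1 \/ s1 = s2 by left.
have s2P : s2 = s1 \/ s2 = s2 by right.
exists (mk s1 s1P), (mk s2 s2P); split.
  split.
    move=> /(congr1 (fun c => dot (perp n) (center c))).
    rewrite /= !dot_shift dot_perpp dot_perpl n1 => h.
    by move/eqP: s12; apply; lra.
  rewrite predeqE => c /=; split=> [/compP[s [_ /roots sE cE xE]]|].
    by case: sE cE xE => -> cE xE; [left|right]; apply: circle_eq.
  move=> [] ->; apply/compP; [exists s1|exists s2]; split=> //.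
  - exact: nz.
  - exact/roots.
  - exact: nz.
  - exact/roots.
(* [n'] is the mirror image of [n] in the line of centres, whose direction is
   [q n + 4 r (perp n)]. *)
pose q := s1 + s2; pose N := 16 * r ^+ 2 + q ^+ 2.
have N0 : 0 < N by rewrite ltr_pwDl ?sqr_ge0 // !mulr_gt0 // exprn_gt0.
have NN : N != 0 by rewrite gt_eqF.
pose al := 1 - 32 * r ^+ 2 / N; pose be := 8 * r * q / N.
pose n' := shift (shift (0, 0) al n) be (perp n).
have dn' p : dot n' p = al * dot n p + be * dot (perp n) p.
  by rewrite /n' /dot /shift /=; ring.
have n1' : dot n' n' = 1.
  rewrite {2}/n' !dot_shift !dn' !dot0 n1 dot_perp dot_perpl dot_perpp n1.
  rewrite /al /be /N; field.
  by rewrite -/N.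
exists [set p | dot n' p = dot n' o - r]; split.
  move=> /esym /(normal_unique n1 n1' wn) h.
  have /(congr1 (dot n)) : n = n' by apply: h; rewrite -/o -/r; ring.
  rewrite n1 /n' !dot_shift dot0 n1 dot_perp /al.
  have : 0 < 32 * r ^+ 2 / N by rewrite divr_gt0 // mulr_gt0 // exprn_gt0.
  by lra.
apply/common_external_tangentP; exists n', (dot n' o - r); split=> // c.
(* Since the roots have sum [q] and product [- (4 * r ^+ 2)], both satisfy this equation. Up to the
   factor [8 * r / N] it is exactly the condition that the companion touch the line with normal
   [n']. *)
have lin s : s = s1 \/ s = s2 -> s ^+ 2 = q * s + 4 * r ^+ 2.
  move=> sE; have : (s - s1) * (s - s2) = 0.
    by case: sE => ->; rewrite subrr ?mulr0 ?mul0r.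
  have -> : (s - s1) * (s - s2) = s ^+ 2 - q * s + s1 * s2 by rewrite /q; ring.
  by rewrite s12E; lra.
have on s h : dot n' (center (mk s h)) - (dot n' o - r) = radius (mk s h).
  rewrite /= !dot_shift.
  have -> : dot n' n = al by rewrite dn' n1 dot_perpl; ring.
  have -> : dot n' (perp n) = be by rewrite dn' dot_perp dot_perpp n1; ring.
  have s2' := lin s h.
  apply/eqP; rewrite -subr_eq0; apply/eqP.
  transitivity (8 * r / N * (q * s + 4 * r ^+ 2 - s ^+ 2)).
    by rewrite /al /be; field; rewrite NN rN.
  by rewrite s2' subrr mulr0.
move=> [[->|->]|->]; [by rewrite -/o -/r; ring|exact: on|exact: on].
Qed.

End Companions.

Theorem theorem1 (R : realType) (k w : circle R) (w_in_k : lies_inside w k) :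
  (exists t : set (plane R), tangent_line t w /\ has_second_common_tangent k w t) ->
  forall t : set (plane R), tangent_line t w -> has_second_common_tangent k w t.
Proof.
move=> [t0 [t0w /(second_tangentP w_in_k t0w) cond]] t tw.
exact/(second_tangentP w_in_k tw).
Qed.
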